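(* Let $\lambda$ be a Borel measure on $\mathbb{R}^d$, let $\emptyset\neq\Omega\subseteq\mathbb{R}^d$ be open with $\lambda(\Omega)<\infty$, and let $K\in\mathcal{K}$ be $\lambda$-symmetric. Assume that the nonlocal Poincaré inequality holds in $V$. Then there is a constant $C>0$ such that the following holds for every $f\in L^2(\Omega,\lambda)$ and every $g:\Gamma\to\mathbb{R}$ satisfying the continuous functional condition, provided that the compatibility condition $$\int_\Omega f(x)w(x)\,\mathrm{d}\lambda(x)+\int_\Gamma g(y)w(y)\,\mathrm{d}\lambda(y)=0\quad\text{for all }w\in\ker\mathcal{B}$$ is satisfied: a weak solution $u\in V$ of the nonlocal Neumann problem ($\mathcal{L}u=f$ in $\Omega$, $\mathcal{N}u=g$ in $\Gamma$) exists, it is unique up to addition of elements $w\in\ker\mathcal{B}$, and the weak solutions $u\in V$ depend continuously on $(f,g)$ in the sense that $$\|u-P(u)\|_V\le C\big(\|f\|_{L^2(\Omega,\lambda)}+\|g\|_\Gamma\big),$$ where $P(u)$ is the unique element of $\ker\mathcal{B}$ with $\langle u-P(u),w\rangle_V=0$ for all $w\in\ker\mathcal{B}$.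
   Context: A transition kernel is a map $K:\mathbb{R}^d\times\mathcal{B}(\mathbb{R}^d)\to[0,\infty]$ ($\mathcal{B}(\mathbb{R}^d)$ the Borel $\sigma$-algebra) such that $K(x,\cdot)$ is a $\sigma$-finite measure for every $x$ and $K(\cdot,A)$ is Borel measurable for every $A$. It is non-degenerated if $x\mapsto\int f(x,y)\,K(x,\mathrm{d}y)$ is Borel measurable for every non-negative Borel measurable $f:\mathbb{R}^d\times\mathbb{R}^d\to\mathbb{R}$; $\mathcal{K}$ is the set of non-degenerated transition kernels. For a Borel measure $\lambda$, $K\in\mathcal{K}$ is $\lambda$-symmetric if $\lambda\otimes K=K\otimes\lambda$, where $(\lambda\otimes K)(M)=\int\int\chi_M(x,y)\,K(x,\mathrm{d}y)\,\mathrm{d}\lambda(x)$ and $(K\otimes\lambda)(M)=\int\int\chi_M(x,y)\,K(y,\mathrm{d}x)\,\mathrm{d}\lambda(y)$. $\Gamma=\{y\in\mathbb{R}^d\setminus\Omega: K(y,\Omega)>0\}$, $\mathcal{L}u(x)=\operatorname{PV}\int_{\mathbb{R}^d}(u(x)-u(y))\,K(x,\mathrm{d}y)$, $\mathcal{N}u(y)=\int_\Omega(u(y)-u(x))\,K(y,\mathrm{d}x)$. $\mathcal{V}$ is the space of Borel measurable $v:\mathbb{R}^d\to\mathbb{R}$ with $\|v\|_{\mathcal{V}}^2=\int_\Omega v^2\,\mathrm{d}\lambda+\int_\Omega\int_{\mathbb{R}^d}(v(x)-v(y))^2\,K(x,\mathrm{d}y)\,\mathrm{d}\lambda(x)<\infty$.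 $V=\mathcal{V}/\ker\|\cdot\|_{\mathcal{V}}$, where $\ker\|\cdot\|_{\mathcal{V}}=\{v\in\mathcal{V}: v=0\ \lambda\text{-a.e. on }\Omega\cup\Gamma\}$, with the inner product $\langle u,v\rangle_V=\int_\Omega uv\,\mathrm{d}\lambda+\int_\Omega\int_{\mathbb{R}^d}(u(x)-u(y))(v(x)-v(y))\,K(x,\mathrm{d}y)\,\mathrm{d}\lambda(x)$ and norm $\|\cdot\|_V$. On $V$ set $$\mathcal{B}(u,v)=\tfrac12\int_\Omega\int_\Omega(u(x)-u(y))(v(x)-v(y))\,K(x,\mathrm{d}y)\,\mathrm{d}\lambda(x)+\int_\Omega\int_{\mathbb{R}^d\setminus\Omega}(u(x)-u(y))(v(x)-v(y))\,K(x,\mathrm{d}y)\,\mathrm{d}\lambda(x)$$ and $\ker\mathcal{B}=\{w\in V:\mathcal{B}(w,w)=0\}$. The nonlocal Poincaré inequality holds in $V$ if there is $C>0$ with $\inf_{w\in\ker\mathcal{B}}\int_\Omega(v-w)^2\,\mathrm{d}\lambda\le C\,\mathcal{B}(v,v)$ for all $v\in V$. A function $g:\Gamma\to\mathbb{R}$ satisfies the continuous functional condition if it is Borel measurable and $v\mapsto\int_\Gamma g(y)v(y)\,\mathrm{d}\lambda(y)$ is a continuous linear functional on $V$; its continuity constant (operator norm) is denoted $\|g\|_\Gamma$. A weak solution of the Neumann problem is $u\in V$ with $\mathcal{B}(u,v)=\int_\Omega fv\,\mathrm{d}\lambda+\int_\Gamma gv\,\mathrm{d}\lambda$ for all $v\in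 V$. *)

(* Defs.v *)
From HB Require Import structures.
From mathcomp Require Import all_boot all_order all_algebra.
From mathcomp Require Import all_classical all_reals all_analysis.
From mathcomp Require Import measurable_realfun.

Set Implicit Arguments.
Unset Strict Implicit.
Unset Printing Implicit Defensive.

Import Order.TTheory GRing.Theory Num.Theory.
Import numFieldNormedType.Exports.

Local Open Scope classical_set_scope.
Local Open Scope ring_scope.

(* R^d with its Borel sigma-algebra, i.e. the one generated by the open sets
   of the usual topology of row vectors. *)
Notation borelRd R d := (g_sigma_algebraType (@open 'rV[R]_d)).

Section kernels.
Context {disp : measure_display} {T : measurableType disp} {R : realType}.
Implicit Types (lambda : {measure set T -> \bar R}) (K : R.-sigmafker T ~> T).

(* [R.-sigmafker T ~> T] is the library's type of maps K such that K x is a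
   sigma-finite measure for each x and K ^~ A is measurable for each
   measurable A.  The sigma-algebra on T * T is the product one; for
   T = R^d it is the Borel sigma-algebra of R^d x R^d. *)
Definition nondegenerate_kernel K : Prop :=
  forall f : T * T -> R, measurable_fun setT f -> (forall z, 0 <= f z) ->
    measurable_fun setT (fun x => \int[K x]_y (f (x, y))%:E)%E.

Definition symmetric_kernel lambda K : Prop :=
  forall M : set (T * T), measurable M ->
    (\int[lambda]_x \int[K x]_y (\1_M (x, y))%:E =
     \int[lambda]_y \int[K y]_x (\1_M (x, y))%:E)%E.

End kernels.

Section neumann.
Context {disp : measure_display} {T : measurableType disp} {R : realType}.
Variables (lambda : {measure set T -> \bar R}) (K : R.-sigmafker T ~> T).
Variable Omega : set T.
Implicit Types (u v w p : T -> R) (f g : T -> R).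

Definition Gamma : set T := [set y | ~ Omega y /\ (0 < K y Omega)%E].

(* Only used where the iterated integral converges absolutely. *)
Definition iint (D E : set T) (h : T -> T -> R) : R :=
  fine (\int[lambda]_(x in D) \int[K x]_(y in E) (h x y)%:E)%E.

Definition Vnorm2e v : \bar R :=
  (\int[lambda]_(x in Omega) ((v x) ^+ 2)%:E
   + \int[lambda]_(x in Omega) \int[K x]_y ((v x - v y) ^+ 2)%:E)%E.

(* The function space before taking the quotient. An element of the quotient
   V is represented by any function of its class: quantifying over V means
   quantifying over Vspace, and equality in V is Veq below. *)
Definition Vspace : set (T -> R) :=
  [set v | measurable_fun setT v /\ (Vnorm2e v < +oo)%E].

Definition kerV : set (T -> R) :=
  [set v | Vspace v /\ v = cst 0 %[ae lambda in Omega `|` Gamma]].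

Definition Veq u v : Prop := kerV (u \- v).

Definition Vdot u v : R :=
  \int[lambda]_(x in Omega) (u x * v x)
  + iint Omega setT (fun x y => (u x - u y) * (v x - v y)).

Definition Vnorm v : R := Num.sqrt (fine (Vnorm2e v)).

Definition Bform u v : R :=
  2^-1 * iint Omega Omega (fun x y => (u x - u y) * (v x - v y))
  + iint Omega (~` Omega) (fun x y => (u x - u y) * (v x - v y)).

Definition kerB : set (T -> R) := [set w | Vspace w /\ Bform w w = 0].

Definition nonlocal_poincare : Prop :=
  exists2 C : R, 0 < C & forall v, Vspace v ->
    (ereal_inf [set \int[lambda]_(x in Omega) ((v x - w x) ^+ 2)%:E | w in kerB]
     <= (C * Bform v v)%:E)%E.

Definition continuous_linear_functional (G : (T -> R) -> R) : Prop :=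
  (forall (a : R) u v, Vspace u -> Vspace v ->
     G (fun x => a * u x + v x) = a * G u + G v) /\
  (forall u, Vspace u -> forall e : R, 0 < e -> exists2 r : R, 0 < r &
     forall v, Vspace v -> Vnorm (v \- u) < r -> `|G v - G u| < e).

Definition operator_norm (G : (T -> R) -> R) : R :=
  sup [set `|G v| | v in [set v | Vspace v /\ Vnorm v <= 1]].

(* A function on Gamma (resp. Omega) is a function on T of which only the
   values on Gamma (resp. Omega) matter. *)
Definition Gamma_functional g v : R := \int[lambda]_(y in Gamma) (g y * v y).

(* Integrability makes the functional well defined and finite on all of V;
   without it the integral would be a meaningless default value. *)
Definition continuous_functional_condition g : Prop :=
  [/\ measurable_fun Gamma g,
      forall v, Vspace v ->
        lambda.-integrable Gamma (fun y => (g y * v y)%:E)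
    & continuous_linear_functional (Gamma_functional g)].

Definition Gamma_norm g : R := operator_norm (Gamma_functional g).

Definition L2_Omega f : Prop := f \_ Omega \in Lfun lambda 2%:E.

Definition L2_Omega_norm f : R :=
  fine ('N[lambda]_2%:E [EFin \o (f \_ Omega)])%E.

Definition neumann_rhs f g v : R :=
  \int[lambda]_(x in Omega) (f x * v x) + Gamma_functional g v.

Definition compatibility f g : Prop :=
  forall w, kerB w -> neumann_rhs f g w = 0.

Definition weak_solution f g u : Prop :=
  Vspace u /\ forall v, Vspace v -> Bform u v = neumann_rhs f g v.

Definition is_kerB_projection u p : Prop :=
  kerB p /\ forall w, kerB w -> Vdot (u \- p) w = 0.

End neumann.

(* Main.v *)
Require Import Defs.
From HB Require Import structures.
From mathcomp Require Import all_boot all_order all_algebra.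
From mathcomp Require Import all_classical all_reals all_analysis.
From mathcomp Require Import measurable_realfun.
From mathcomp Require Import ring lra.
Import Order.TTheory GRing.Theory Num.Theory.
Import numFieldNormedType.Exports.
Local Open Scope classical_set_scope.
Local Open Scope ring_scope.

(** The Neumann problem is a Riesz representation problem on the orthogonal
complement of [kerB] in [V].

The space [V] with [Vdot] is a complete semi-inner product space, and
[0 <= Bform v v <= Vdot v v].  By Cauchy-Schwarz for [Bform], the null space
[kerB] is the common kernel of the bounded functionals [Bform^~ w], so it is
closed and orthogonal projections onto it exist.  If [v] is orthogonal to
[kerB] then the distance from [v] to [kerB] is the norm of [v]; as the energy
part of [Vdot v v] is at most [2 * Bform v v], the Poincare inequality with
constant [C] yields [Vdot v v <= (C + 2) * Bform v v] on the complement
([coercive_on_complement]).  There [Bform] is thus an inner product equivalent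
to [Vdot], the complement is complete for it, and the right-hand side, bounded
by the assumptions on [f] and [g], is represented by some [u].  Compatibility
extends the equation from the complement to all of [V].  Two solutions differ
by an element of [kerB], and testing the equation for [u] with
[u - P u] gives the estimate with the constant [C + 2], which depends on
neither [f] nor [g].

The analytic part is that [V] is complete ([Vspace_fast_complete]) and that the
null vectors of [Vdot] are the functions vanishing almost everywhere on
[Omega `|` Gamma] ([Vdot_eq0]).  Both become statements on ordinary
[L^2] spaces once the iterated integrals are written as integrals for one
measure on [T * T], namely the restriction of lambda to [Omega] composed with
the kernel ([pair_measure]).  A function [v] belongs to [V] when [v] is
square integrable on [Omega] and its difference [v x - v y] is square
integrable for that measure.  A fast Cauchy sequence converges almost
everywhere in both senses, hence at almost every second coordinate [y] as
well, and the lemma of Fatou turns the pointwise limit into a limit in [V].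
Symmetry enters through the second marginal of that measure, which has density
[K y Omega] with respect to lambda: a set is null for it exactly when
[K y Omega = 0] at almost all of its points, so that outside [Omega] it sees
[Gamma] and nothing else. *)

Set Implicit Arguments.
Unset Strict Implicit.
Unset Printing Implicit Defensive.

(** * Two real inequalities *)

Section real_lemmas.
Context {R : realType}.

Lemma le0_of_le_geometric (x M : R) : (forall n, x <= M / 4 ^+ n) -> x <= 0.
Proof.
move=> xM; have M4 : (fun n => M / 4 ^+ n) @ \oo --> (0 : R).
  have -> : (fun n => M / 4 ^+ n) = geometric M (4^-1 : R).
    by apply/funext => n; rewrite /geometric /= exprVn.
  by apply: cvg_geometric; rewrite normfV ger0_norm// invf_lt1 ?ltr1n.
by apply: (cvgr_to_ge M4); exact: nearW.
Qed.

Lemma discriminant_le (a b c : R) : 0 <= a ->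
  (forall t, 0 <= a * t ^+ 2 + 2 * b * t + c) -> b ^+ 2 <= a * c.
Proof.
rewrite le_eqVlt => /predU1P[<- H|a0 H].
  have [->|b0] := eqVneq b 0; first by rewrite expr0n mul0r.
  have := H (- (c + 1) / (2 * b)).
  suff -> : 0 * (- (c + 1) / (2 * b)) ^+ 2 + 2 * b * (- (c + 1) / (2 * b)) + c
      = -1 by rewrite ler0N1.
  by field.
have := H (- b / a).
have -> : a * (- b / a) ^+ 2 + 2 * b * (- b / a) + c = (a * c - b ^+ 2) / a.
  by field; rewrite gt_eqF.
by rewrite pmulr_lge0 ?invr_gt0// subr_ge0.
Qed.

End real_lemmas.

(** * Complete semi-inner product spaces *)

Section semi_hilbert.
Context {R : realType} {E : lmodType R}.
Implicit Types (X : set E) (dot : E -> E -> R) (G : E -> R).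

Definition linear_subspace X : Prop :=
  X 0 /\ forall a u v, X u -> X v -> X (a *: u + v).

Definition linear_on X G : Prop :=
  forall a u v, X u -> X v -> G (a *: u + v) = a * G u + G v.

(** The axioms are relative to a subspace [X] of an ambient module: the forms
of interest are given by integrals, which behave linearly only on functions
for which they converge.  Null vectors are allowed, so no quotient has to be
formed. *)
Record semi_inner_product X dot : Prop := SemiInnerProduct {
  sip_subspace : linear_subspace X ;
  sipC : forall u v, X u -> X v -> dot u v = dot v u ;
  sip_linear : forall w, X w -> linear_on X (dot^~ w) ;
  sip_ge0 : forall u, X u -> 0 <= dot u u }.

(** Completeness along Cauchy sequences of geometric rate, the only ones the
projection and representation arguments produce.  The constants [M] and [M']
are free so that the property passes to equivalent semi-inner products. *)
Definition fast_complete X dot : Prop :=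
  forall (M : R) (v : nat -> E), (forall n, X (v n)) ->
    (forall n k, (n <= k)%N -> dot (v k - v n) (v k - v n) <= M / 4 ^+ n) ->
  exists2 u, X u & exists M', forall n, dot (u - v n) (u - v n) <= M' / 4 ^+ n.

(** The bound is squared, which avoids square roots of [dot v v]. *)
Definition bounded_functional X dot G : Prop :=
  linear_on X G /\ exists c, forall v, X v -> G v ^+ 2 <= c * dot v v.

Section subspace.
Variable X : set E.
Hypothesis subX : linear_subspace X.

Lemma subspaceD u v : X u -> X v -> X (u + v).
Proof. by move=> Xu Xv; rewrite -[u]scale1r; exact: subX.2. Qed.

Lemma subspaceZ a u : X u -> X (a *: u).
Proof. by move=> Xu; rewrite -[_ *: _]addr0; apply: subX.2 => //; exact: subX.1. Qed.

Lemma subspaceB u v : X u -> X v -> X (u - v).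
Proof. by move=> Xu Xv; rewrite addrC -scaleN1r; exact: subX.2. Qed.

Variable G : E -> R.
Hypothesis linG : linear_on X G.

Lemma linear_onD u v : X u -> X v -> G (u + v) = G u + G v.
Proof. by move=> Xu Xv; rewrite -[u in LHS]scale1r linG// mul1r. Qed.

Lemma linear_on0 : G 0 = 0.
Proof.
by have := linG 1 subX.1 subX.1; rewrite scale1r addr0 mul1r => /eqP;
  rewrite addrC -subr_eq subrr => /eqP.
Qed.

Lemma linear_onZ a u : X u -> G (a *: u) = a * G u.
Proof.
by move=> Xu; rewrite -[_ *: _]addr0 linG ?linear_on0 ?addr0//; exact: subX.1.
Qed.

Lemma linear_onB u v : X u -> X v -> G (u - v) = G u - G v.
Proof. by move=> Xu Xv; rewrite addrC -scaleN1r linG// mulN1r addrC. Qed.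

End subspace.

Section semi_inner_product_theory.
Context X dot (sip : semi_inner_product X dot).

Let subX := sip_subspace sip.
Let XD := subspaceD subX.
Let XZ := subspaceZ subX.
Let XB := subspaceB subX.

Lemma sip_linear_r w : X w -> linear_on X (dot w).
Proof.
move=> Xw a u v Xu Xv; rewrite (sipC sip)// ?(sip_linear sip)//; last exact: subX.2.
by rewrite !(sipC sip Xw).
Qed.

Lemma sip_expand a u v : X u -> X v ->
  dot (u + a *: v) (u + a *: v) =
  dot v v * a ^+ 2 + 2 * dot u v * a + dot u u.
Proof.
move=> Xu Xv; have Xav := XZ a Xv.
rewrite (linear_onD (sip_linear sip (XD Xu Xav)))//.
rewrite !(linear_onD (sip_linear_r _))//.
rewrite !(linear_onZ subX (sip_linear_r _))//.
rewrite !(linear_onZ subX (sip_linear sip _))//.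
by rewrite (sipC sip Xv Xu); ring.
Qed.

Lemma sip_CauchySchwarz u v : X u -> X v ->
  dot u v ^+ 2 <= dot u u * dot v v.
Proof.
move=> Xu Xv; rewrite mulrC; apply: discriminant_le; first exact: (sip_ge0 sip).
by move=> t; rewrite -sip_expand//; apply: (sip_ge0 sip); apply: XD => //; exact: XZ.
Qed.

Lemma sip_null u v : X u -> X v -> dot u u = 0 -> dot u v = 0.
Proof.
move=> Xu Xv u0; have := sip_CauchySchwarz Xu Xv.
by rewrite u0 mul0r => H; apply/eqP; rewrite -sqrf_eq0 eq_le H sqr_ge0.
Qed.

Lemma sip_bounded_functional w : X w -> bounded_functional X dot (dot^~ w).
Proof.
move=> Xw; split; first exact: (sip_linear sip).
by exists (dot w w) => v Xv; rewrite mulrC; exact: (sip_CauchySchwarz Xv Xw).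
Qed.

(** The representing vector minimizes [dot v v - 2 * G v].  The parallelogram
identity makes a minimizing sequence Cauchy; the Euler equation is not derived
at the minimizer but along the sequence, with a quantitative error given by
the discriminant inequality, which avoids passing to the limit in the
quadratic functional. *)
Theorem riesz_representation G : fast_complete X dot ->
  bounded_functional X dot G ->
  exists2 u, X u & forall v, X v -> dot u v = G v.
Proof.
move=> cX [linG [c Gc]].
pose J v := dot v v - 2 * G v.
have JE v w t : X v -> X w -> J (v + t *: w) =
    dot w w * t ^+ 2 + 2 * (dot v w - G w) * t + J v.
  move=> Xv Xw; rewrite /J sip_expand// (linear_onD linG) ?(linear_onZ subX linG)//.
    by ring.
  exact: XZ.
have Jlb : lbound [set J v | v in X] (- `|c|).
  move=> _ [v Xv <-]; rewrite /J leNgt; apply/negP => H.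
  have q0 := sip_ge0 sip Xv; have c0 := normr_ge0 c.
  have : G v ^+ 2 <= `|c| * dot v v.
    by apply: le_trans (Gc v Xv) _; rewrite ler_wpM2r// ler_norm.
  (* Otherwise [2 * G v] would exceed [`|c| + dot v v], which is at least
     twice the geometric mean of its terms. *)
  have : (`|c| + dot v v) ^+ 2 < (2 * G v) ^+ 2.
    by rewrite ltrXn2r// ?nnegrE; lra.
  have := sqr_ge0 (`|c| - dot v v); nra.
have hJ : has_inf [set J v | v in X].
  split; last by exists (- `|c|).
  by exists (J 0), 0; [exact: subX.1|].
pose m := inf [set J v | v in X].
have mJ v : X v -> m <= J v by move=> Xv; apply: ge_inf; [exact: hJ.2|exists v].
have /choice[v_ Pv] n : exists v, X v /\ J v <= m + 1 / 4 ^+ n.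
  have e0 : 0 < 1 / 4 ^+ n :> R by rewrite divr_gt0// exprn_gt0.
  have [_ [v Xv <-] /ltW Jv] := inf_adherent e0 hJ.
  by exists v.
have Xv n := (Pv n).1.
have [||u Xu [M' uM']] := cX 4 v_ => //.
  move=> n k nk; have mid := mJ _ (XZ 2^-1 (XD (Xv k) (Xv n))).
  have : 1 / 4 ^+ k <= 1 / 4 ^+ n :> R.
    by rewrite !div1r lef_pV2 ?posrE ?exprn_gt0// ler_eXn2l// ltr1n.
  (* Parallelogram identity: compare the values at both points and at their
     midpoint, where the functional is at least its infimum.  Half the
     squared distance is at most the sum of two errors [4 ^- n], whence the
     rate constant 4. *)
  have := (Pv n).2; have := (Pv k).2.
  have E1 : v_ k = v_ n + 1 *: (v_ k - v_ n) by rewrite scale1r addrC subrK.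
  have E2 : 2^-1 *: (v_ k + v_ n) = v_ n + 2^-1 *: (v_ k - v_ n).
    rewrite -[v_ k - v_ n]/(v_ k + - v_ n) !scalerDr scalerN addrCA; congr (_ + _).
    rewrite -[X in X - _]scale1r -scalerBl; congr (_ *: _).
    by field.
  have Xd := XB (Xv k) (Xv n).
  move: mid; rewrite E2 {2}E1 !JE//.
  by move: (dot _ _) (J _) (_ - G _) => q j b; lra.
exists u => // w Xw; apply/eqP; rewrite -subr_eq0 -sqrf_eq0 eq_le sqr_ge0 andbT.
apply: (@le0_of_le_geometric _ _ (2 * (1 + M') * dot w w)) => n.
(* The value at [v_ n] is within [4 ^- n] of the infimum, so the quadratic
   polynomial in [t] below is nonnegative. *)
have h1 : (dot (v_ n) w - G w) ^+ 2 <= dot w w * (1 / 4 ^+ n).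
  apply: discriminant_le; first exact: (sip_ge0 sip).
  move=> t; have := mJ _ (XD (Xv n) (XZ t Xw)); rewrite JE//.
  by have := (Pv n).2; lra.
have h2 : (dot u w - dot (v_ n) w) ^+ 2 <= M' / 4 ^+ n * dot w w.
  rewrite -(linear_onB (sip_linear sip Xw))//.
  apply: le_trans (sip_CauchySchwarz (XB Xu (Xv n)) Xw) _.
  by rewrite ler_wpM2r ?uM'//; exact: (sip_ge0 sip).
have := sqr_ge0 ((dot u w - dot (v_ n) w) - (dot (v_ n) w - G w)).
have -> : 2 * (1 + M') * dot w w / 4 ^+ n =
  2 * (dot w w * (1 / 4 ^+ n)) + 2 * (M' / 4 ^+ n * dot w w) by ring.
by nra.
Qed.

Definition annihilator (F : set (E -> R)) : set E :=
  [set v | X v /\ forall G, F G -> G v = 0].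

(** Closed subspaces are handled as common kernels of bounded functionals:
both [kerB] and its orthogonal complement have this form. *)
Lemma annihilator_sip (F : set (E -> R)) : F `<=` bounded_functional X dot ->
  semi_inner_product (annihilator F) dot.
Proof.
move=> Fb; split=> [|u v [Xu _] [Xv _]|w [Xw _] a u v [Xu _] [Xv _]|u [Xu _]].
- split; first by split; [exact: subX.1|move=> G /Fb[linG _]; exact: linear_on0 linG].
  move=> a u v [Xu uF] [Xv vF]; split; first exact: subX.2.
  by move=> G FG; have [linG _] := Fb _ FG; rewrite linG// uF// vF// mulr0 addr0.
- exact: (sipC sip).
- exact: (sip_linear sip).
- exact: (sip_ge0 sip).
Qed.

Lemma annihilator_fast_complete (F : set (E -> R)) :
  F `<=` bounded_functional X dot ->
  fast_complete X dot -> fast_complete (annihilator F) dot.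
Proof.
move=> Fb cX M v Xv vM.
have [u Xu [M' uM']] := cX M v (fun n => (Xv n).1) vM.
exists u; last by exists M'.
split=> // G FG; have [linG [c Gc]] := Fb _ FG.
apply/eqP; rewrite -sqrf_eq0 eq_le sqr_ge0 andbT.
apply: (@le0_of_le_geometric _ _ (`|c| * M')) => n.
have Xun := XB Xu (Xv n).1.
have -> : G u = G (u - v n).
  by rewrite (linear_onB linG Xu (Xv n).1) ((Xv n).2 _ FG) subr0.
apply: le_trans (Gc _ Xun) _; rewrite -mulrA.
apply: le_trans (ler_wpM2r (sip_ge0 sip Xun) (ler_norm c)) _.
by rewrite ler_wpM2l.
Qed.

End semi_inner_product_theory.

(** * The Neumann problem in a semi-inner product space *)

(** [B] is dominated by [dot] and its null space [N] satisfies a Poincare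
inequality.  The infimum over [N] is expressed by approximate minimizers, since
it need not be attained a priori. *)
Section abstract_neumann.
Context X dot B (sipd : semi_inner_product X dot) (sipB : semi_inner_product X B).
Variable c : R.
Hypotheses (c0 : 0 < c) (cX : fast_complete X dot).
Hypothesis Bdot : forall v, X v -> B v v <= dot v v.
Let N : set E := [set w | X w /\ B w w = 0].
Hypothesis poincare : forall v, X v -> forall e, 0 < e ->
  exists2 w, N w & dot (v - w) (v - w) <= c * B v v + e.

Let subX := sip_subspace sipd.

Lemma null_space_annihilator : N = annihilator X [set B^~ w | w in X].
Proof.
apply/seteqP; split=> [u [Xu u0]|u [Xu uF]].
  by split=> // _ [w Xw <-]; exact: (sip_null sipB).
by split=> //; apply: (uF (B^~ u)); exists u.
Qed.

Lemma form_bounded_functional w : X w -> bounded_functional X dot (B^~ w).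
Proof.
move=> Xw; split; first exact: (sip_linear sipB).
exists (B w w) => v Xv; rewrite mulrC; apply: le_trans (sip_CauchySchwarz sipB Xv Xw) _.
by rewrite ler_wpM2r ?Bdot ?(sip_ge0 sipB).
Qed.

Lemma null_space_sip : semi_inner_product N dot.
Proof.
rewrite null_space_annihilator; apply: (annihilator_sip sipd).
by move=> _ [w Xw <-]; exact: form_bounded_functional.
Qed.

Lemma null_space_projection u : X u ->
  exists2 p, N p & forall w, N w -> dot (u - p) w = 0.
Proof.
move=> Xu.
have cN : fast_complete N dot.
  rewrite null_space_annihilator; apply: (annihilator_fast_complete sipd) => //.
  by move=> _ [w Xw <-]; exact: form_bounded_functional.
have [|p Np pE] := @riesz_representation _ _ null_space_sip (dot u) cN.
  split; first by move=> a v w [Xv _] [Xw _]; exact: (sip_linear_r sipd Xu).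
  by exists (dot u u) => v [Xv _]; exact: (sip_CauchySchwarz sipd).
exists p => // w Nw; have [Xp _] := Np; have [Xw _] := Nw.
by rewrite (linear_onB (sip_linear sipd Xw))// pE// subrr.
Qed.

Let Nperp : set E := annihilator X [set dot^~ w | w in N].

(** For [v] orthogonal to [N], subtracting an element of [N] only increases
the norm, so that the Poincare inequality bounds [dot v v] itself. *)
Lemma coercive_on_complement v : Nperp v -> dot v v <= c * B v v.
Proof.
move=> [Xv vN]; apply/ler_addgt0Pr => e e0.
have [w Nw] := poincare Xv e0; have [Xw _] := Nw.
have vw : dot v w = 0 by apply: (vN (dot^~ w)); exists w.
rewrite -scaleN1r (sip_expand sipd)// vw.
by have := sip_ge0 sipd Xw; lra.
Qed.

(** On the complement of [N] the form [B] is equivalent to [dot], so it is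
complete there and represents [G].  A general test vector splits into a part
in the complement and a part in [N], on which both sides vanish. *)
Theorem abstract_neumann_existence G : bounded_functional X dot G ->
  (forall w, N w -> G w = 0) -> exists2 u, X u & forall v, X v -> B u v = G v.
Proof.
move=> [linG [k Gk]] GN.
have Nb : [set dot^~ w | w in N] `<=` bounded_functional X dot.
  by move=> _ [w [Xw _] <-]; exact: (sip_bounded_functional sipd).
have subN := annihilator_sip sipd Nb.
have sipN : semi_inner_product Nperp B.
  split=> [|u v [Xu _] [Xv _]|w [Xw _] a u v [Xu _] [Xv _]|u [Xu _]].
  - exact: sip_subspace subN.
  - exact: (sipC sipB).
  - exact: (sip_linear sipB).
  - exact: (sip_ge0 sipB).
have cN : fast_complete Nperp B.
  move=> M v Nv vM.
  have [||u Nu [M' uM']] := annihilator_fast_complete sipd Nb cX (M := c * M) (v := v) => //.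
    move=> n l nl; rewrite -mulrA; apply: le_trans (ler_wpM2l (ltW c0) (vM n l nl)).
    by apply: coercive_on_complement; exact: (subspaceB (sip_subspace subN) (Nv l) (Nv n)).
  exists u => //; exists M' => n; apply: le_trans (uM' n); apply: Bdot.
  by have [Xun _] := subspaceB (sip_subspace subN) Nu (Nv n).
have [|u Nu uE] := @riesz_representation _ _ sipN G cN.
  split; first by move=> a u v [Xu _] [Xv _]; exact: linG.
  exists (`|k| * c) => v Nv; have [Xv _] := Nv.
  apply: le_trans (Gk v Xv) _; rewrite -mulrA.
  apply: le_trans (ler_wpM2r (sip_ge0 sipd Xv) (ler_norm k)) _.
  by rewrite ler_wpM2l//; exact: coercive_on_complement.
have [Xu _] := Nu; exists u => // v Xv.
have [p Np pE] := null_space_projection Xv; have [Xp p0] := Np.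
have Xvp := subspaceB subX Xv Xp.
have Nvp : Nperp (v - p) by split=> // _ [w Nw <-]; exact: pE.
rewrite -[v](subrK p) (linear_onD (sip_linear_r sipB Xu))// (linear_onD linG)//.
by rewrite (uE _ Nvp) (GN _ Np) (sipC sipB Xu Xp) (sip_null sipB Xp Xu p0).
Qed.

(** With [z = u - p], coercivity gives
[dot z z <= c * B z z = c * B u z = c * G z], and one factor of the norm of
[z] cancels. *)
Theorem abstract_neumann_stability G u (k : R) : 0 <= k ->
  (forall v, X v -> `|G v| <= k * Num.sqrt (dot v v)) ->
  X u -> (forall v, X v -> B u v = G v) ->
  forall p, N p -> (forall w, N w -> dot (u - p) w = 0) ->
    Num.sqrt (dot (u - p) (u - p)) <= c * k.
Proof.
move=> k0 Gk Xu uE p [Xp p0] pE; have Xz := subspaceB subX Xu Xp.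
have Nz : Nperp (u - p) by split=> // _ [w Nw <-]; exact: pE.
have Bz : B (u - p) (u - p) = G (u - p).
  rewrite {1}(linear_onB (sip_linear sipB Xz))// uE//.
  by rewrite (sip_null sipB Xp Xz p0) subr0.
have := coercive_on_complement Nz; rewrite Bz.
have := le_trans (ler_norm _) (Gk _ Xz).
set s := Num.sqrt _; have s0 : 0 <= s by rewrite sqrtr_ge0.
rewrite -[dot _ _]sqr_sqrtr ?(sip_ge0 sipd)// -/s => h1 h2.
have h3 : s * s <= c * k * s.
  by rewrite -expr2 (le_trans h2)// -mulrA ler_wpM2l// ltW.
have [->|sn0] := eqVneq s 0; first by rewrite mulr_ge0// ltW.
by rewrite -(ler_pM2r (x := s))// lt_def sn0.
Qed.

End abstract_neumann.

End semi_hilbert.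

(** * Constructions of semi-inner products *)

Section sip_constructions.
Context {R : realType}.

Lemma sip_eq {E : lmodType R} (X : set E) (dot dot' : E -> E -> R) :
  semi_inner_product X dot ->
  (forall u v, X u -> X v -> dot' u v = dot u v) -> semi_inner_product X dot'.
Proof.
move=> sip eqd; have subX := sip_subspace sip; split=> //.
- by move=> u v Xu Xv; rewrite !eqd//; exact: (sipC sip).
- move=> w Xw a u v Xu Xv; rewrite !eqd//; first exact: (sip_linear sip).
  exact: subX.2.
- by move=> u Xu; rewrite eqd//; exact: (sip_ge0 sip).
Qed.

Lemma sip_add {E : lmodType R} (X : set E) (dot dot' : E -> E -> R) a :
  0 <= a -> semi_inner_product X dot -> semi_inner_product X dot' ->
  semi_inner_product X (fun u v => a * dot u v + dot' u v).
Proof.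
move=> a0 sip sip'; split; first exact: sip_subspace sip.
- by move=> u v Xu Xv; rewrite (sipC sip)// (sipC sip').
- move=> w Xw b u v Xu Xv.
  by rewrite (sip_linear sip Xw)// (sip_linear sip' Xw)//; ring.
- by move=> u Xu; rewrite addr_ge0 ?mulr_ge0 ?(sip_ge0 sip) ?(sip_ge0 sip').
Qed.

(** The pullback of a semi-inner product along a linear map; it is used with
the map from [v] to its difference function. *)
Lemma sip_comp {E E' : lmodType R} (X : set E) (dot : E -> E -> R)
    (Y : set E') (L : E' -> E) :
  semi_inner_product X dot -> linear_subspace Y ->
  (forall a u v, L (a *: u + v) = a *: L u + L v) ->
  (forall u, Y u -> X (L u)) ->
  semi_inner_product Y (fun u v => dot (L u) (L v)).
Proof.
move=> sip subY linL XL; split=> //.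
- by move=> u v Yu Yv; rewrite (sipC sip)//; exact: XL.
- by move=> w Yw a u v Yu Yv; rewrite linL (sip_linear sip)//; exact: XL.
- by move=> u Yu; rewrite (sip_ge0 sip)//; exact: XL.
Qed.

Lemma sip_norm_CauchySchwarz {E : lmodType R} (X : set E) (dot : E -> E -> R) u v :
  semi_inner_product X dot -> X u -> X v ->
  `|dot u v| <= Num.sqrt (dot u u) * Num.sqrt (dot v v).
Proof.
move=> sip Xu Xv; rewrite -sqrtrM ?(sip_ge0 sip)// -sqrtr_sqr ler_wsqrtr//.
exact: (sip_CauchySchwarz sip).
Qed.

End sip_constructions.

(** * Square-integrable functions *)

Section square_integrable.
Context d (T : measurableType d) (R : realType).
Variables (mu : {measure set T -> \bar R}) (D : set T) (mD : measurable D).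
Implicit Types u v w : T -> R.

Definition square_integrable : set (T -> R) :=
  [set u : T -> R | measurable_fun D u /\
           (\int[mu]_(x in D) ((u x) ^+ 2)%:E < +oo)%E].

Definition l2dot u v : R := \int[mu]_(x in D) (u x * v x).

Lemma integrable_sqr u : square_integrable u ->
  mu.-integrable D (EFin \o (fun x => u x ^+ 2)).
Proof.
move=> [mfu u_fin]; apply/integrableP; split.
  exact/measurable_EFinP/measurable_funX.
by under eq_integral => x _ do rewrite gee0_abs ?lee_fin ?sqr_ge0//.
Qed.

Lemma integrable_mul u v : square_integrable u -> square_integrable v ->
  mu.-integrable D (EFin \o (fun x => u x * v x)).
Proof.
move=> L2u L2v; have [[mfu _] [mv _]] := (L2u, L2v).
apply: (le_integrable mD _ _ (integrableD mD (integrable_sqr L2u) (integrable_sqr L2v))).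
  exact/measurable_EFinP/measurable_funM.
move=> x _ /=; rewrite lee_fin [leRHS]ger0_norm ?addr_ge0 ?sqr_ge0//.
by rewrite ler_norml; have := sqr_ge0 (u x - v x); have := sqr_ge0 (u x + v x); nra.
Qed.

Lemma square_integrable_subspace : linear_subspace square_integrable.
Proof.
split.
  split; first exact: measurable_cst.
  by under eq_integral do rewrite /= expr0n; rewrite integral0 ltry.
move=> a u v L2u L2v; have [[mfu _] [mv _]] := (L2u, L2v).
have muv : measurable_fun D (a *: u + v).
  by apply: measurable_funD => //; exact: measurable_funM.
split=> //; apply: (@le_lt_trans _ _ (\int[mu]_(x in D)
    (2 * a ^+ 2 * u x ^+ 2 + 2 * v x ^+ 2)%:E)%E).
  apply: ge0_le_integral => //.
  - by move=> x _; rewrite lee_fin sqr_ge0.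
  - exact/measurable_EFinP/measurable_funX.
  - apply/measurable_EFinP; apply: measurable_funD; apply: measurable_funM => //;
      exact: measurable_funX.
  - move=> x _; rewrite lee_fin /= -[(a *: u + v) x]/(a * u x + v x).
    by have := sqr_ge0 (a * u x - v x); nra.
have iu := integrableZl mD (2 * a ^+ 2) (integrable_sqr L2u).
have iv := integrableZl mD 2 (integrable_sqr L2v).
have := integrable_lty mD (integrableD mD iu iv).
by under eq_integral do rewrite /= -!EFinM -EFinD.
Qed.

Lemma l2dot_sip : semi_inner_product square_integrable l2dot.
Proof.
split; first exact: square_integrable_subspace.
- by move=> u v _ _; apply: eq_Rintegral => x _; rewrite mulrC.
- move=> w L2w a u v L2u L2v; rewrite /l2dot.
  have iu := integrable_mul L2u L2w; have iv := integrable_mul L2v L2w.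
  rewrite -RintegralZl// -RintegralD//; last exact: (integrableZl mD a iu).
  by apply: eq_Rintegral => x _; rewrite -[(a *: u + v) x]/(a * u x + v x); ring.
- by move=> u _; apply: Rintegral_ge0 => x _; rewrite -expr2 sqr_ge0.
Qed.

Lemma l2dotE u : square_integrable u ->
  (\int[mu]_(x in D) ((u x) ^+ 2)%:E)%E = (l2dot u u)%:E.
Proof.
move=> L2u; rewrite /l2dot /Rintegral fineK//.
by rewrite integrable_fin_num//; exact: integrable_mul.
Qed.

(** With [d n] the n-th increment, the weighted series of the
[2 ^+ n * d n ^+ 2] has finite integral, hence converges almost everywhere, and
[`|d n| <= 2 ^- n + 2 ^+ n * d n ^+ 2] makes the telescopic series absolutely
convergent there. *)
Lemma fast_cauchy_ae_cvg (v : nat -> T -> R) (M : R) :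
  (forall n, measurable_fun D (v n)) ->
  (forall n, (\int[mu]_(x in D) ((v n.+1 x - v n x) ^+ 2)%:E <= (M / 4 ^+ n)%:E)%E) ->
  {ae mu, forall x, D x -> cvgn (v ^~ x)}.
Proof.
move=> mv vM; pose f n x : \bar R := (2 ^+ n * (v n.+1 x - v n x) ^+ 2)%:E.
have f0 n x : (0 <= f n x)%E by rewrite lee_fin mulr_ge0 ?sqr_ge0// exprn_ge0.
have mf n : measurable_fun D (f n).
  apply/measurable_EFinP; apply: measurable_funM => //.
  by apply: measurable_funX; exact: measurable_funB.
have mS : measurable_fun D (fun x => \sum_(n <oo) f n x)%E.
  by apply: ge0_emeasurable_sum => //.
have intS : mu.-integrable D (fun x => \sum_(n <oo) f n x)%E.
  apply/integrableP; split=> //.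
  under eq_integral => x _ do rewrite gee0_abs ?nneseries_ge0//.
  rewrite integral_nneseries//.
  apply: (@le_lt_trans _ _ (\sum_(k <oo) ((2 * M) / (2 ^ (k + 1))%:R)%:E)%E).
    apply: lee_nneseries => [n _ _|n _]; first exact: integral_ge0.
    rewrite /f; under eq_integral do rewrite EFinM.
    rewrite ge0_integralZl_EFin ?exprn_ge0//; last 2 first.
    - by move=> x _; rewrite lee_fin sqr_ge0.
    - by apply/measurable_EFinP; apply: measurable_funX; exact: measurable_funB.
    apply: le_trans (lee_wpmul2l _ (vM n)) _; first by rewrite lee_fin exprn_ge0.
    rewrite -EFinM lee_fin addn1 expnS natrM natrX.
    have -> : 4 = 2 * 2 :> R by rewrite -natrM.
    rewrite exprMn; have : 2 ^+ n != 0 :> R by rewrite expf_neq0.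
    by move=> n0; rewrite le_eqVlt; apply/orP; left; apply/eqP; field.
  have /cvg_lim -> // := @cvg_geometric_eseries_half R (2 * M) 0.
  exact: ltry.
have := integrable_ae mD intS; apply: filterS => x + Dx => /(_ Dx) finS.
have cS : cvgn (series (fun n => 2 ^+ n * (v n.+1 x - v n x) ^+ 2)).
  apply: nnseries_is_cvg => [n|]; first by rewrite mulr_ge0 ?sqr_ge0// exprn_ge0.
  by rewrite ltey_eq finS.
have cg : cvgn (series (geometric 1 (2^-1 : R))).
  by apply: is_cvg_geometric_series; rewrite normfV ger0_norm// invf_lt1 ?ltr1n.
have cT : cvgn (series (telescope (v ^~ x))).
  apply: normed_cvg; apply: series_le_cvg (is_cvg_seriesD cg cS) => n.
  - exact: normr_ge0.
  - by apply: addr_ge0; apply: mulr_ge0 => //; rewrite ?sqr_ge0 ?exprn_ge0.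
  - rewrite -[X in _ <= X]/(1 * 2^-1 ^+ n + 2 ^+ n * (v n.+1 x - v n x) ^+ 2).
    rewrite -[X in X <= _]/(`|v n.+1 x - v n x|) exprVn mul1r.
    have p0 : 0 < 2 ^+ n :> R by rewrite exprn_gt0.
    set t := v _ x - v _ x; rewrite -[t ^+ 2]real_normK ?num_real//.
    move: (2 ^+ n) p0 `|t| (normr_ge0 t) => p p0 s s0.
    rewrite -(ler_pM2r p0) mulrDl mulVf ?gt_eqF//.
    by have := sqr_ge0 (s * p - 1); have := mulr_ge0 s0 (ltW p0); nra.
have -> : v ^~ x = cst (v 0%N x) + series (telescope (v ^~ x)).
  by apply/funext => n; exact: (eq_sum_telescope (v ^~ x)).
by apply: is_cvgD => //; exact: is_cvg_cst.
Qed.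

(** Distances to a fixed function pass to an almost everywhere limit by the
lemma of Fatou; the limit need not be known to be square integrable. *)
Lemma fatou_sqr (v : nat -> T -> R) u w n (C : \bar R) :
  (forall k, measurable_fun D (v k)) -> measurable_fun D u -> measurable_fun D w ->
  {ae mu, forall x, D x -> v ^~ x @ \oo --> u x} ->
  (forall k, (n <= k)%N -> (\int[mu]_(x in D) ((v k x - w x) ^+ 2)%:E <= C)%E) ->
  (\int[mu]_(x in D) ((u x - w x) ^+ 2)%:E <= C)%E.
Proof.
move=> mv mfu mw vu vC.
pose f k x : \bar R := ((v (k + n)%N x - w x) ^+ 2)%:E.
have mf k : measurable_fun D (f k).
  by apply/measurable_EFinP; apply: measurable_funX; exact: measurable_funB.
have f0 k x : D x -> (0 <= f k x)%E by move=> _; rewrite lee_fin sqr_ge0.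
rewrite (@ge0_ae_eq_integral _ _ _ _ _ _ (fun x => limn_einf (f ^~ x))) //.
- apply: le_trans (fatou mu mD mf f0) _.
  rewrite limn_einf_lim; apply: lime_le; first exact: is_cvg_einfs.
  apply: nearW => k; apply: le_trans (vC (k + n)%N (leq_addl _ _)).
  by apply: ereal_inf_lbound; exists k => //=.
- by apply/measurable_EFinP; apply: measurable_funX; exact: measurable_funB.
- apply: measurableT_comp => //; apply: measurable_fun_limn_esup => k.
  exact: measurableT_comp.
- by move=> x _; rewrite lee_fin sqr_ge0.
- move=> x Dx; rewrite limn_einf_lim; apply: lime_ge; first exact: is_cvg_einfs.
  by apply: nearW => k; apply: le_ereal_inf_tmp => _ [m _ <-]; exact: f0.
- apply: filterS vu => x /= + Dx => /(_ Dx) vux; apply/esym.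
  apply: (fun l => (@cvg_limn_einf_sup R (f ^~ x) ((u x - w x) ^+ 2)%:E l).1).
  apply: cvg_EFin; first exact: nearW.
  have := vux; rewrite -(cvg_shiftn n) => vun.
  by apply: cvgM; apply: cvgB => //; exact: cvg_cst.
Qed.

End square_integrable.

Lemma square_integrable_subset d (T : measurableType d) (R : realType)
    (m : {measure set T -> \bar R}) (D D' : set T) (u : T -> R) :
  measurable D -> measurable D' -> D' `<=` D ->
  square_integrable m D u -> square_integrable m D' u.
Proof.
move=> mD mD' D'D [mfu ufin]; have mu' := measurable_funS mD D'D mfu; split=> //.
apply: le_lt_trans ufin; apply: ge0_subset_integral => //.
- exact/measurable_EFinP/measurable_funX.
- by move=> x _; rewrite lee_fin sqr_ge0.
Qed.

(** * The measure composed of a measure and a kernel *)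

Section pair_measure.
Context {d} {T : measurableType d} {R : realType}.
Variables (lambda : {measure set T -> \bar R}) (K : R.-sigmafker T ~> T).
Variables (Omega : set T).
Local Open Scope ereal_scope.

(** The measure [lambda (x) K] restricted to first coordinates in [Omega].
Non-degeneracy of the kernel is what makes the inner integrals measurable, so
the two hypotheses are arguments of the definition: the measure structure
below is found by unification from them. *)
Definition pair_measure of measurable Omega & nondegenerate_kernel K :=
  fun A : set (T * T) =>
    \int[lambda]_(x in Omega) \int[K x]_y (\1_A (x, y) : R)%:E.

Variables (mO : measurable Omega) (ndK : nondegenerate_kernel K).
Notation mu := (pair_measure mO ndK).

Lemma measurable_inner_integral (D : set T) (f : T * T -> R) :
  measurable_fun setT f -> (forall z, (0 <= f z)%R) ->
  measurable_fun D (fun x => \int[K x]_y (f (x, y))%:E).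
Proof. by move=> mf f0; apply: measurable_funTS; exact: ndK. Qed.

Lemma measurable_section (f : T * T -> R) x :
  measurable_fun setT f -> measurable_fun setT (fun y => (f (x, y))%:E).
Proof. by move=> mf; apply/measurable_EFinP; exact: measurableT_comp. Qed.

Let pair_measure0 : mu set0 = 0.
Proof.
rewrite /pair_measure; under eq_integral do (under eq_integral do rewrite indic0).
by under eq_integral do rewrite integral0; rewrite integral0.
Qed.

Let pair_measure_ge0 A : 0 <= mu A.
Proof. by apply: integral_ge0 => x _; apply: integral_ge0 => y _; rewrite lee_fin. Qed.

Let pair_measure_sigma_additive : semi_sigma_additive mu.
Proof.
move=> F mF tF mUF.
have -> : mu (\bigcup_n F n) = \sum_(n <oo) mu (F n).
  rewrite /pair_measure -integral_nneseries//; last 2 first.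
  - by move=> n; exact: (measurable_inner_integral (f := \1_(F n))).
  - by move=> n x _; apply: integral_ge0 => y _; rewrite lee_fin.
  apply: eq_integral => x _; rewrite -integral_nneseries//; last first.
    by move=> n; apply: (@measurable_section (\1_(F n))); exact: measurable_indic.
  by apply: eq_integral => y _; rewrite indic_bigcup.
by apply: is_cvg_nneseries => n _ _; exact: pair_measure_ge0.
Qed.

HB.instance Definition _ := isMeasure.Build _ _ R mu
  pair_measure0 pair_measure_ge0 pair_measure_sigma_additive.

End pair_measure.

Section pair_measure_integral.
Context d (T : measurableType d) (R : realType).
Variables (lambda : {measure set T -> \bar R}) (K : R.-sigmafker T ~> T).
Variables (Omega : set T).
Variables (mO : measurable Omega) (ndK : nondegenerate_kernel K).
Local Open Scope ereal_scope.

Notation mu := (pair_measure lambda mO ndK).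

Import HBNNSimple.

Let integral_pair_measure_nnsfun (f : {nnsfun T * T >-> R}) :
  \int[mu]_z (f z)%:E =
  \int[lambda]_(x in Omega) \int[K x]_y (f (x, y))%:E.
Proof.
pose t r z : R := (r * \1_(f @^-1` [set r]) z)%R.
have t0 r z : (0 <= t r z)%R.
  have [r0|r0] := leP 0%R r; first by rewrite mulr_ge0.
  by rewrite /t preimage_nnfun0// indic0 mulr0.
have mt r : measurable_fun setT (t r).
  by apply: measurable_funM => //; exact: measurable_indic.
have fE z : (f z)%:E = \sum_(r \in range f) (t r z)%:E.
  by rewrite fsumEFin// fimfunE.
under [LHS]eq_integral => z _ do rewrite fE.
rewrite ge0_integral_fsum//; last 2 first.
- by move=> r; exact/measurable_EFinP.
- by move=> r z _; rewrite lee_fin.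
under [RHS]eq_integral.
  move=> x _; under eq_integral => y _ do rewrite fE.
  rewrite ge0_integral_fsum//; last 2 first.
  - by move=> r; exact: measurable_section.
  - by move=> r z _; rewrite lee_fin.
  over.
rewrite ge0_integral_fsum//; last 2 first.
- by move=> r; exact: (measurable_inner_integral ndK).
- by move=> r x _; apply: integral_ge0 => y _; rewrite lee_fin.
apply: eq_fsbigr => r _.
have [r0|r0] := leP 0%R r; last first.
  have tr0 z : t r z = 0%R by rewrite /t preimage_nnfun0// indic0 mulr0.
  rewrite integral0_eq => [|z _]; last by rewrite tr0.
  by rewrite integral0_eq// => x _; rewrite integral0_eq// => y _; rewrite tr0.
under eq_integral do rewrite EFinM.
rewrite ge0_integralZl_EFin//; last first.
  by apply/measurable_EFinP; exact: measurable_indic.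
rewrite integral_indic// setIT.
under [RHS]eq_integral.
  move=> x _; under eq_integral do rewrite /t EFinM.
  rewrite ge0_integralZl_EFin//; last first.
    by apply: (@measurable_section _ _ _ (\1_(f @^-1` [set r]))); exact: measurable_indic.
  over.
rewrite ge0_integralZl_EFin//.
- by move=> x _; apply: integral_ge0 => y _; rewrite lee_fin.
- exact: (measurable_inner_integral ndK (f := \1_(f @^-1` [set r]))).
Qed.

(** The kernel is sigma-finite at each point but need not be s-finite as a
kernel, and non-degeneracy speaks of real-valued functions only; approximation
by simple functions stays within these bounds. *)
Lemma integral_pair_measure (f : T * T -> R) :
  measurable_fun setT f -> (forall z, (0 <= f z)%R) ->
  \int[mu]_z (f z)%:E =
  \int[lambda]_(x in Omega) \int[K x]_y (f (x, y))%:E.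
Proof.
move=> mf f0.
have mEf : measurable_fun setT (EFin \o f) by exact/measurable_EFinP.
pose f_ := nnsfun_approx measurableT mEf.
have f_f z : (f_ n z)%:E @[n --> \oo] --> (f z)%:E.
  by apply: (cvg_nnsfun_approx _ mEf) => // *; rewrite lee_fin.
have nd_f z : nondecreasing_seq (fun n => (f_ n z)%:E).
  by move=> a b ab; rewrite lee_fin; exact/lefP/nd_nnsfun_approx.
have f_0 n z : 0 <= (f_ n z)%:E by rewrite lee_fin.
have mf_ n : measurable_fun setT (f_ n) by [].
have step (m : {measure set T -> \bar R}) x :
    \int[m]_y (f (x, y))%:E = limn (fun n => \int[m]_y (f_ n (x, y))%:E).
  rewrite -monotone_convergence//; last by move=> n; exact: measurable_section.
  by apply: eq_integral => y _; apply/esym/cvg_lim.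
have step2 x : {homo (fun n => \int[K x]_y (f_ n (x, y))%:E) : a b / (a <= b)%N >-> a <= b}.
  move=> a b ab; apply: ge0_le_integral => //.
  - exact: measurable_section.
  - exact: measurable_section.
  - by move=> y _; exact: nd_f.
transitivity (limn (fun n => \int[mu]_z (f_ n z)%:E)).
  rewrite -monotone_convergence//; last by move=> n; exact/measurable_EFinP.
  by apply: eq_integral => z _; apply/esym/cvg_lim.
under eq_fun do rewrite integral_pair_measure_nnsfun.
rewrite -monotone_convergence//; last 2 first.
- by move=> n; exact: (measurable_inner_integral ndK).
- by move=> n x _; exact: integral_ge0.
by apply: eq_integral => x _; exact/esym/step.
Qed.

End pair_measure_integral.

Section pair_measure_signed.
Context d (T : measurableType d) (R : realType).
Variables (lambda : {measure set T -> \bar R}) (K : R.-sigmafker T ~> T).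
Variables (Omega : set T).
Variables (mO : measurable Omega) (ndK : nondegenerate_kernel K).
Local Open Scope ereal_scope.

Notation mu := (pair_measure lambda mO ndK).

(** The integral of a signed function is by definition the difference of the
integrals of its positive and negative parts, at both levels; integrability
for the pair measure makes both outer integrals finite, so that they can be
subtracted. *)
Lemma integrable_pair_measure (f : T * T -> R) : mu.-integrable setT (EFin \o f) ->
  \int[mu]_z (f z)%:E =
  \int[lambda]_(x in Omega) \int[K x]_y (f (x, y))%:E.
Proof.
move=> intf; have mf : measurable_fun setT f.
  by apply/measurable_EFinP; exact: measurable_int intf.
pose A (h : T * T -> R) x := \int[K x]_y (h (x, y))%:E.
have mp : measurable_fun setT (f^\+)%R by exact: measurable_funrpos.
have mn : measurable_fun setT (f^\-)%R by exact: measurable_funrneg.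
have p0 z : (0 <= f^\+ z)%R by exact: funrpos_ge0.
have n0 z : (0 <= f^\- z)%R by exact: funrneg_ge0.
have intA (h : T * T -> R) : measurable_fun setT h -> (forall z, (0 <= h z)%R) ->
    mu.-integrable setT (EFin \o h) -> lambda.-integrable Omega (A h).
  move=> mh h0 /integrableP[_ hfin]; apply/integrableP; split.
    exact: (measurable_inner_integral ndK).
  under eq_integral => x _.
    rewrite gee0_abs; last by apply: integral_ge0 => y _; rewrite lee_fin.
    over.
  rewrite -(integral_pair_measure lambda mO)//.
  by under eq_integral => z _ do rewrite -[(h z)%:E]gee0_abs ?lee_fin//.
have ip : mu.-integrable setT (EFin \o f^\+%R).
  by rewrite -funerpos; exact: integrable_funepos.
have in_ : mu.-integrable setT (EFin \o f^\-%R).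
  by rewrite -funerneg; exact: integrable_funeneg.
have -> : \int[mu]_z (f z)%:E =
    \int[mu]_z (f^\+%R z)%:E - \int[mu]_z (f^\-%R z)%:E.
  by rewrite integralE; congr (_ - _); apply: eq_integral => z _;
    rewrite ?funeposE ?funenegE /funrpos /funrneg EFin_max.
rewrite !integral_pair_measure// -(integralB mO (intA _ mp p0 ip) (intA _ mn n0 in_)).
apply: eq_integral => x _; rewrite [RHS]integralE /A.
by congr (_ - _); apply: eq_integral => y _;
  rewrite ?funeposE ?funenegE /funrpos /funrneg EFin_max.
Qed.

Lemma section_restrict (f : T * T -> R) (m : {measure set T -> \bar R}) E x :
  \int[m]_(y in E) (f (x, y))%:E =
  \int[m]_y ((f \_ (setT `*` E)) (x, y))%:E.
Proof.
rewrite integral_mkcond; apply: eq_integral => y _.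
by rewrite !patchE in_setX in_setT; case: (y \in E).
Qed.

Lemma integrable_pair_measure_in (f : T * T -> R) E : measurable E ->
  mu.-integrable (setT `*` E) (EFin \o f) ->
  \int[lambda]_(x in Omega) \int[K x]_(y in E) (f (x, y))%:E =
  \int[mu]_(z in setT `*` E) (f z)%:E.
Proof.
move=> mE intf; have mTE : measurable (setT `*` E : set (T * T)).
  exact: measurableX.
under eq_integral do rewrite section_restrict.
rewrite -integrable_pair_measure//.
  by rewrite [RHS]integral_mkcond; apply: eq_integral => z _; rewrite !patchE; case: ifP.
by rewrite -restrict_EFin; apply/(integrable_mkcond _ mTE).
Qed.

Lemma ae_fst (P : T -> Prop) :
  {ae lambda, forall x, Omega x -> P x} -> {ae mu, forall z, P z.1}.
Proof.
move=> [N [mN N0 PN]].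
have mB : measurable ((N `|` ~` Omega) `*` setT : set (T * T)).
  by apply: measurableX => //; apply: measurableU => //; exact: measurableC.
exists ((N `|` ~` Omega) `*` setT); split=> //; last first.
  move=> [x y] /= nP; split=> //=.
  have [Ox|nOx] := pselect (Omega x); last by right.
  by left; apply: PN => /= /(_ Ox).
rewrite /= /pair_measure.
rewrite (@ge0_ae_eq_integral _ _ _ _ _ _ (cst 0)) ?integral0//.
- exact: (measurable_inner_integral ndK (f := \1_((N `|` ~` Omega) `*` setT))).
- by move=> x _; apply: integral_ge0 => y _; rewrite lee_fin.
- exists N; split=> // x /= /not_implyP[Ox nx0]; apply: contrapT => Nx; apply: nx0.
  rewrite integral0_eq// => y _; rewrite indicE memNset//=.
  by move=> [[/= ?|/= ?] _].
Qed.

(** The second marginal has density [K y Omega]: this is the symmetry identity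
applied to the rectangle [Omega `*` A]. *)
Lemma pair_measure_snd A : symmetric_kernel lambda K -> measurable A ->
  mu (setT `*` A) = \int[lambda]_(y in A) K y Omega.
Proof.
move=> symK mA; rewrite /= /pair_measure integral_mkcond.
transitivity (\int[lambda]_x \int[K x]_y (\1_(Omega `*` A) (x, y) : R)%:E).
  apply: eq_integral => x _; rewrite patchE; case: ifPn => Ox.
    by apply: eq_integral => y _; rewrite !indicE !in_setX in_setT Ox.
  by rewrite integral0_eq// => y _; rewrite indicE in_setX (negbTE Ox).
rewrite symK; last exact: measurableX.
rewrite [RHS]integral_mkcond; apply: eq_integral => y _; rewrite patchE.
case: ifPn => Ay.
  have -> : K y Omega = \int[K y]_x (\1_Omega x : R)%:E by rewrite integral_indic// setIT.
  by apply: eq_integral => x _; rewrite !indicE in_setX Ay andbT.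
by rewrite integral0_eq// => x _; rewrite indicE in_setX (negbTE Ay) andbF.
Qed.

End pair_measure_signed.

(** * The energy space *)

Section energy_space.
Context {d} {T : measurableType d} {R : realType}.
Variables (lambda : {measure set T -> \bar R}) (K : R.-sigmafker T ~> T).
Variables (Omega : set T).
Variables (mO : measurable Omega) (ndK : nondegenerate_kernel K).

Notation mu := (pair_measure lambda mO ndK).
Notation V := (Vspace lambda K Omega).
Notation dotV := (Vdot lambda K Omega).
Notation B := (Bform lambda K Omega).
Notation dotO := (l2dot lambda Omega).
Notation dotE E := (l2dot mu (setT `*` E)).

Definition difference (u : T -> R) (z : T * T) : R := u z.1 - u z.2.

Lemma difference_linear a u v :
  difference (a *: u + v) = a *: difference u + difference v.
Proof.
apply/funext => z.
rewrite -[RHS]/(a * (u z.1 - u z.2) + (v z.1 - v z.2)).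
rewrite -[LHS]/((a * u z.1 + v z.1) - (a * u z.2 + v z.2)); ring.
Qed.

Lemma measurable_difference u : measurable_fun setT u ->
  measurable_fun setT (difference u).
Proof. by move=> mfu; apply: measurable_funB; exact: measurableT_comp. Qed.

Let mTE E : measurable E -> measurable (setT `*` E : set (T * T)).
Proof. by move=> mE; exact: measurableX. Qed.

Lemma Vnorm2eE u : measurable_fun setT u -> Vnorm2e lambda K Omega u =
  (\int[lambda]_(x in Omega) ((u x) ^+ 2)%:E +
   \int[mu]_(z in setT `*` setT) ((difference u z) ^+ 2)%:E)%E.
Proof.
move=> mfu; congr (_ + _)%E; rewrite setXTT (integral_pair_measure lambda mO ndK)//.
  by apply: measurable_funX; exact: measurable_difference.
by move=> z; rewrite sqr_ge0.
Qed.

Lemma VspaceE u : V u <-> [/\ measurable_fun setT u,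
  square_integrable lambda Omega u &
  square_integrable mu (setT `*` setT) (difference u)].
Proof.
split=> [[mfu ufin]|[mfu [_ uO] [_ uD]]]; last first.
  by split=> //; rewrite Vnorm2eE//; exact: lte_add_pinfty.
move: ufin; rewrite Vnorm2eE// => ufin; split=> //; split.
- exact: measurable_funTS.
- apply: le_lt_trans ufin; apply: leeDl; apply: integral_ge0 => z _.
  by rewrite lee_fin sqr_ge0.
- by apply: measurable_funTS; exact: measurable_difference.
- apply: le_lt_trans ufin; apply: leeDr; apply: integral_ge0 => z _.
  by rewrite lee_fin sqr_ge0.
Qed.

Lemma Vspace_measurable u : V u -> measurable_fun setT u.
Proof. by case. Qed.

Lemma Vspace_sqr u : V u -> square_integrable lambda Omega u.
Proof. by move=> /VspaceE[]. Qed.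

Lemma Vspace_difference_sqr E u : measurable E -> V u ->
  square_integrable mu (setT `*` E) (difference u).
Proof.
move=> mE /VspaceE[_ _]; apply: square_integrable_subset; [exact: mTE|exact: mTE|].
by move=> z [].
Qed.

Lemma iint_l2dot E u v : measurable E -> V u -> V v ->
  iint lambda K Omega E (fun x y => (u x - u y) * (v x - v y)) =
  dotE E (difference u) (difference v).
Proof.
move=> mE Vu Vv.
rewrite /iint (integrable_pair_measure_in (mO := mO) (ndK := ndK)
  (f := fun z => difference u z * difference v z))//.
by apply: integrable_mul; [exact: mTE| |]; exact: Vspace_difference_sqr.
Qed.

Lemma VdotE u v : V u -> V v ->
  dotV u v = dotO u v + dotE setT (difference u) (difference v).
Proof. by move=> Vu Vv; rewrite /Vdot iint_l2dot. Qed.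

Lemma BformE u v : V u -> V v ->
  B u v = 2^-1 * dotE Omega (difference u) (difference v)
          + dotE (~` Omega) (difference u) (difference v).
Proof. by move=> Vu Vv; rewrite /Bform !iint_l2dot//; exact: measurableC. Qed.

Lemma Vspace_subspace : linear_subspace V.
Proof.
have [sO0 sO] := square_integrable_subspace lambda mO.
have [sD0 sD] := square_integrable_subspace mu (mTE measurableT).
have d0 : difference 0 = 0 by apply/funext => z; exact: subrr.
split; first by apply/VspaceE; split; rewrite ?d0//; exact: measurable_cst.
move=> a u v /VspaceE[mfu uO uD] /VspaceE[mv vO vD]; apply/VspaceE; split.
- by apply: measurable_funD => //; exact: measurable_funM.
- exact: sO.
- by rewrite difference_linear; exact: sD.
Qed.

Lemma difference_sip E : measurable E ->
  semi_inner_product V (fun u v => dotE E (difference u) (difference v)).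
Proof.
move=> mE; apply: (sip_comp (l2dot_sip mu (mTE mE)) Vspace_subspace).
  exact: difference_linear.
by move=> u; exact: Vspace_difference_sqr.
Qed.

Lemma l2dot_Omega_sip : semi_inner_product V dotO.
Proof.
by apply: (sip_comp (L := id) (l2dot_sip lambda mO) Vspace_subspace) => // u /Vspace_sqr.
Qed.

Lemma Vdot_sip : semi_inner_product V dotV.
Proof.
apply: sip_eq (sip_add ler01 l2dot_Omega_sip (difference_sip measurableT)) _.
by move=> u v Vu Vv; rewrite mul1r VdotE.
Qed.

Lemma Bform_sip : semi_inner_product V B.
Proof.
have h : 0 <= 2^-1 :> R by [].
apply: sip_eq (sip_add h (difference_sip mO) (difference_sip (measurableC mO))) _.
exact: BformE.
Qed.

Lemma difference_split u : V u -> dotE setT (difference u) (difference u) =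
  dotE Omega (difference u) (difference u)
  + dotE (~` Omega) (difference u) (difference u).
Proof.
move=> Vu; have mOc := measurableC mO.
have TE : setT `*` setT = setT `*` Omega `|` setT `*` ~` Omega :> set (T * T).
  apply/seteqP; split=> [z _|//].
  by have [zO|zO] := pselect (Omega z.2); [left|right].
rewrite /l2dot TE Rintegral_setU//; [exact: mTE|exact: mTE| |].
  rewrite -TE; apply: integrable_mul; first exact: mTE.
    exact: Vspace_difference_sqr.
  exact: Vspace_difference_sqr.
apply/disj_setPS => z [[_ /= zO] [_ /=]]; exact.
Qed.

Lemma Bform_le_Vdot u : V u -> B u u <= dotV u u.
Proof.
move=> Vu; rewrite BformE// VdotE// difference_split//.
have := sip_ge0 (difference_sip mO) Vu.
have := sip_ge0 l2dot_Omega_sip Vu; lra.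
Qed.

(** Pairs inside [Omega] carry the weight one half in [Bform], whence the
factor 2. *)
Lemma Vdot_le_Bform u : V u -> dotV u u <= dotO u u + 2 * B u u.
Proof.
move=> Vu; rewrite BformE// VdotE// difference_split//.
have := sip_ge0 (difference_sip (measurableC mO)) Vu; lra.
Qed.

Lemma Vnorm2e_Vdot u : V u -> Vnorm2e lambda K Omega u = (dotV u u)%:E.
Proof.
move=> Vu; rewrite Vnorm2eE; last exact: Vspace_measurable.
rewrite VdotE// EFinD (l2dotE mO (Vspace_sqr Vu)).
by rewrite (l2dotE (mTE measurableT) (Vspace_difference_sqr measurableT Vu)).
Qed.

Lemma Vnorm_Vdot u : V u -> Vnorm lambda K Omega u = Num.sqrt (dotV u u).
Proof. by move=> Vu; rewrite /Vnorm Vnorm2e_Vdot. Qed.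

(** The values converge almost everywhere on [Omega] and the differences
converge for almost every pair, so the values also converge at the second
coordinate of almost every pair.  The limit is therefore defined pointwise as
an upper limit, which is measurable and right wherever the sequence
converges. *)
Lemma Vspace_fast_complete : fast_complete V dotV.
Proof.
move=> M v Vv vM; have subV := Vspace_subspace.
have VB n k : V (v k - v n) by exact: subspaceB.
have mv n := Vspace_measurable (Vv n).
have mvO n : measurable_fun Omega (v n) by exact: measurable_funTS.
have mdv n : measurable_fun (setT `*` setT) (difference (v n)).
  by apply: measurable_funTS; exact: measurable_difference.
have vO n k : (n <= k)%N ->
    (\int[lambda]_(x in Omega) ((v k x - v n x) ^+ 2)%:E <= (M / 4 ^+ n)%:E)%E.
  move=> nk; have := l2dotE mO (Vspace_sqr (VB n k)); rewrite /= => ->.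
  rewrite lee_fin; apply: le_trans (vM n k nk); rewrite VdotE// lerDl.
  exact: (sip_ge0 (difference_sip measurableT)).
have difB u w z : difference (u - w) z = difference u z - difference w z.
  by rewrite /difference /=; rewrite -[(u - w) z.1]/(u z.1 - w z.1)
    -[(u - w) z.2]/(u z.2 - w z.2); ring.
have vD n k : (n <= k)%N -> (\int[mu]_(z in setT `*` setT)
    ((difference (v k) z - difference (v n) z) ^+ 2)%:E <= (M / 4 ^+ n)%:E)%E.
  move=> nk; under eq_integral do rewrite -difB.
  have Vd := Vspace_difference_sqr measurableT (VB n k).
  rewrite (l2dotE (mTE measurableT) Vd).
  rewrite lee_fin; apply: le_trans (vM n k nk); rewrite VdotE// lerDr.
  exact: (sip_ge0 l2dot_Omega_sip).
have cO := fast_cauchy_ae_cvg mO mvO (fun n => vO n n.+1 (leqnSn n)).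
have cD := fast_cauchy_ae_cvg (mTE measurableT) mdv (fun n => vD n n.+1 (leqnSn n)).
pose u x := fine (limn_esup (fun n => (v n x)%:E)).
have uE x l : v ^~ x @ \oo --> l -> u x = l.
  move=> vl; rewrite /u.
  have : (fun n => (v n x)%:E) @ \oo --> l%:E by apply: cvg_EFin => //; exact: nearW.
  by move=> /cvg_limn_einf_sup[_ ->].
have mfu : measurable_fun setT u.
  apply: measurableT_comp => //; apply: measurable_fun_limn_esup => n.
  exact/measurable_EFinP.
have uO : {ae lambda, forall x, Omega x -> v ^~ x @ \oo --> u x}.
  by apply: filterS cO => x + Ox => /(_ Ox)/cvg_ex[l vl]; rewrite (uE x l).
have uD : {ae mu, forall z, (setT `*` setT) z ->
    (fun n => difference (v n) z) @ \oo --> difference u z}.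
  have c1 := @ae_fst _ _ _ lambda K Omega mO ndK _ cO.
  apply: filterS2 c1 cD => -[x y] /= /cvg_ex[a va] + _.
  move=> /(_ (conj I I))/cvg_ex[b vb].
  rewrite /difference /= (uE x a)// (uE y (a - b)).
    by have -> : a - (a - b) = b by ring.
  have -> : v ^~ y = v ^~ x - (fun n => difference (v n) (x, y)).
    by apply/funext => n; rewrite -[RHS]/(v n x - (v n x - v n y)); ring.
  exact: (cvgB va vb).
have mun n : measurable_fun setT (u - v n) by exact: measurable_funB.
have boundO n : (\int[lambda]_(x in Omega) ((u x - v n x) ^+ 2)%:E <= (M / 4 ^+ n)%:E)%E.
  apply: (fatou_sqr mO mvO _ (mvO n) uO (n := n)); first exact: measurable_funTS.
  by move=> k nk; exact: vO.
have boundD n : (\int[mu]_(z in setT `*` setT)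
    ((difference (u - v n) z) ^+ 2)%:E <= (M / 4 ^+ n)%:E)%E.
  under eq_integral do rewrite difB.
  apply: (fatou_sqr (mTE measurableT) mdv _ (mdv n) uD (n := n)).
    by apply: measurable_funTS; exact: measurable_difference.
  by move=> k nk; exact: vD.
have bound n : (Vnorm2e lambda K Omega (u - v n)%R <= (2 * M / 4 ^+ n)%:E)%E.
  rewrite Vnorm2eE//.
  have -> : 2 * M / 4 ^+ n = M / 4 ^+ n + M / 4 ^+ n by ring.
  by rewrite EFinD; apply: leeD; [exact: boundO|exact: boundD].
have Vun n : V (u - v n).
  by split=> //; apply: le_lt_trans (bound n) _; rewrite ltry.
exists u; first by rewrite -[u](subrK (v 0%N)); exact: subspaceD.
by exists (2 * M) => n; have := bound n; rewrite Vnorm2e_Vdot// lee_fin.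
Qed.

Section symmetric.
Hypothesis symK : symmetric_kernel lambda K.

Lemma ae_snd_null (A : set T) : measurable A ->
  mu (setT `*` A) = 0%E <->
  {ae lambda, forall y, A y -> ~ (0 < K y Omega)%E}.
Proof.
move=> mA; rewrite (pair_measure_snd _ _ symK)//.
have mK : measurable_fun A (fun y => K y Omega).
  by apply: measurable_funTS; exact: measurable_kernel.
have -> : (\int[lambda]_(y in A) K y Omega = \int[lambda]_(y in A) `|K y Omega|)%E.
  by apply: eq_integral => y _; rewrite gee0_abs.
rewrite (ae_eq_integral_abs lambda mA mK); split; apply: filterS => y /= + Ay => /(_ Ay).
  by move=> ->; rewrite ltxx.
by move=> /negP; rewrite -leNgt => K0; apply/eqP; rewrite eq_le K0 measure_ge0.
Qed.

(** If [Vdot v v = 0] then [v x = 0] and [v x = v y] for almost every pair, so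
the set where [v] is nonzero is null for the second marginal, that is,
[K y Omega] vanishes at almost all of its points; this excludes [Gamma].  The
converse reads the same chain backwards. *)
Lemma Vdot_eq0 v : V v -> dotV v v = 0 <-> kerV lambda K Omega v.
Proof.
move=> Vv; have mv := Vspace_measurable Vv.
pose A := [set y | v y != 0].
have mA : measurable A.
  have -> : A = setT `&` v @^-1` [set~ 0].
    by rewrite setTI; apply/seteqP; split=> y /=; [move/eqP|move=> /eqP].
  by apply: mv => //; exact: measurableC.
have mTA := mTE mA.
have sO := Vspace_sqr Vv; have sD := Vspace_difference_sqr measurableT Vv.
have sq0 (d' : measure_display) (T' : measurableType d')
    (m : {measure set T' -> \bar R}) (D : set T') (u : T' -> R) :
    measurable D -> square_integrable m D u ->
    l2dot m D u u = 0 <-> {ae m, forall x, D x -> u x = 0}.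
  move=> mD su; have [mfu _] := su.
  have mu2 : measurable_fun D (fun x => (u x ^+ 2)%:E).
    exact/measurable_EFinP/measurable_funX.
  have E0 : l2dot m D u u = 0 <-> (\int[m]_(x in D) `|(u x ^+ 2)%:E| = 0)%E.
    under eq_integral do rewrite gee0_abs ?lee_fin ?sqr_ge0//.
    by rewrite (l2dotE mD su); split=> [->//|[]].
  rewrite E0 (ae_eq_integral_abs m mD mu2); split; apply: filterS => x /= + Dx => /(_ Dx).
    by move=> [] /eqP; rewrite sqrf_eq0 => /eqP.
  by move=> ->; rewrite expr0n.
have V0 : dotV v v = 0 <-> {ae lambda, forall x, Omega x -> v x = 0} /\
    {ae mu, forall z, (setT `*` setT) z -> difference v z = 0}.
  rewrite -(sq0 _ _ _ _ _ mO sO) -(sq0 _ _ _ _ _ (mTE measurableT) sD) VdotE//.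
  have := sip_ge0 l2dot_Omega_sip Vv.
  have := sip_ge0 (difference_sip measurableT) Vv.
  by split=> [h|[-> ->]]; [split; lra|rewrite addr0].
rewrite V0; split=> [[vO vD]|[_ v0]].
  split=> //; have /(ae_snd_null mA) vA : mu (setT `*` A) = 0%E.
    apply/negligibleP => //.
    have v1 := @ae_fst _ _ _ lambda K Omega mO ndK _ vO.
    have : {ae mu, forall z, v z.2 = 0}.
      apply: filterS2 v1 vD => z /= z1 /(_ (conj I I)); rewrite /difference z1 sub0r.
      by move=> /eqP; rewrite oppr_eq0 => /eqP.
    by apply: negligibleS => z [_ /= /eqP].
  apply: filterS2 vO vA => y vO vA [/vO //|[_ Ky]].
  by apply: contrapT => /eqP vy; exact: vA Ky.
have vO : {ae lambda, forall x, Omega x -> v x = 0}.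
  by apply: filterS v0 => y vy Oy; apply: vy; left.
split=> //.
have : mu (setT `*` A) = 0%E.
  rewrite (pair_measure_snd _ _ symK)//.
  have mK : measurable_fun A (fun y => K y Omega).
    by apply: measurable_funTS; exact: measurable_kernel.
  rewrite (@ge0_ae_eq_integral _ _ _ _ _ _ (cst 0%E)) ?integral0//.
  apply: filterS v0 => y vy /= /eqP Ay; apply/eqP; rewrite eq_le measure_ge0 andbT leNgt.
  apply/negP => Ky; apply: Ay; apply: vy.
  by have [Oy|nOy] := pselect (Omega y); [left|right].
move=> /(@negligibleP _ _ _ mu _ mTA) nA.
have v2 : {ae mu, forall z, v z.2 = 0}.
  by apply: negligibleS nA => z /= /eqP.
have v1 := @ae_fst _ _ _ lambda K Omega mO ndK _ vO.
by apply: filterS2 v1 v2 => z z1 z2 _; rewrite /difference z1 z2 subrr.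
Qed.

End symmetric.

End energy_space.

(** * The data and the solution of the Neumann problem *)

Section neumann_data.
Context {d} {T : measurableType d} {R : realType}.
Variables (lambda : {measure set T -> \bar R}) (K : R.-sigmafker T ~> T).
Variables (Omega : set T).
Variables (mO : measurable Omega) (ndK : nondegenerate_kernel K).

Notation V := (Vspace lambda K Omega).
Notation dotV := (Vdot lambda K Omega).
Notation normV := (Vnorm lambda K Omega).
Notation B := (Bform lambda K Omega).

Let sipV : semi_inner_product V dotV.
Proof. exact: Vdot_sip. Qed.

Let subV : linear_subspace V.
Proof. exact: Vspace_subspace. Qed.

Let normVE v : V v -> normV v = Num.sqrt (dotV v v).
Proof. exact: Vnorm_Vdot. Qed.

Lemma VnormZ a v : V v -> normV (a *: v) = `|a| * normV v.
Proof.
move=> Vv; have Vav := subspaceZ subV a Vv.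
rewrite !normVE// -sqrtr_sqr -sqrtrM ?sqr_ge0//; congr Num.sqrt.
rewrite (linear_onZ subV (sip_linear sipV Vav) a Vv).
by rewrite (linear_onZ subV (sip_linear_r sipV Vv) a Vv) mulrA expr2.
Qed.

Section operator_norm.
Variable G : (T -> R) -> R.
Hypothesis cG : continuous_linear_functional lambda K Omega G.

Lemma continuous_linear_on : linear_on V G.
Proof. by move=> a u v; exact: cG.1. Qed.

(** Continuity at 0 bounds the functional on a small ball, hence on the unit
ball by homogeneity: the supremum defining the operator norm is over a bounded
set. *)
Lemma operator_norm_ub v : V v -> normV v <= 1 ->
  `|G v| <= operator_norm lambda K Omega G.
Proof.
move=> Vv v1; apply: ub_le_sup; last by exists v.
have [r r0 Gr] := cG.2 0 subV.1 1 ltr01.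
exists (2 / r) => _ [u [Vu u1] <-].
have Vru := subspaceZ subV (r / 2) Vu.
have r2 : 0 < r / 2 by rewrite divr_gt0.
have lt_r : normV ((r / 2) *: u) < r.
  rewrite (VnormZ _ Vu) gtr0_norm//.
  by rewrite (le_lt_trans (ler_wpM2l (ltW r2) u1))// mulr1 ltr_pdivrMr// ltr_pMr// ltr1n.
have := Gr _ Vru; rewrite (_ : (r / 2) *: u \- 0 = (r / 2) *: u); last first.
  by apply/funext => x; exact: subr0.
move=> /(_ lt_r); rewrite (linear_on0 subV continuous_linear_on) subr0.
rewrite (linear_onZ subV continuous_linear_on)// normrM gtr0_norm//.
by rewrite -ltr_pdivlMl// invf_div mulr1 => /ltW.
Qed.

Lemma operator_norm_ge0 : 0 <= operator_norm lambda K Omega G.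
Proof.
apply: le_trans (normr_ge0 _) (operator_norm_ub subV.1 _).
by rewrite (normVE subV.1) (linear_on0 subV (sip_linear sipV subV.1)) sqrtr0.
Qed.

(** As [v] may be a nonzero null vector it cannot be normalized; it is scaled
by the inverse of its norm plus a small amount instead. *)
Lemma operator_norm_le v : V v ->
  `|G v| <= operator_norm lambda K Omega G * normV v.
Proof.
move=> Vv; set c := operator_norm _ _ _ _.
have c0 : 0 <= c := operator_norm_ge0; have v0 : 0 <= normV v := sqrtr_ge0 _.
apply/ler_addgt0Pr => e e0.
pose s := normV v + e / (c + 1).
have c1 : 0 < c + 1 by lra.
have es : 0 < e / (c + 1) by rewrite divr_gt0.
have s0 : 0 < s by rewrite /s; lra.
have s1 : normV (s^-1 *: v) <= 1.
  by rewrite VnormZ// gtr0_norm ?invr_gt0// mulrC ler_pdivrMr// mul1r /s; lra.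
have := operator_norm_ub (subspaceZ subV s^-1 Vv) s1.
rewrite (linear_onZ subV continuous_linear_on)// normrM gtr0_norm ?invr_gt0// -/c.
rewrite mulrC ler_pdivrMr// /s mulrDr => h; apply: le_trans h _.
by rewrite lerD2l mulrCA ger_pMr// ler_pdivrMr// mul1r lerDl ler01.
Qed.

End operator_norm.

Lemma L2_Omega_square_integrable f : L2_Omega lambda Omega f ->
  square_integrable lambda Omega f.
Proof.
move=> Lf; have := Lfun2_integrable_sqr Lf => /integrableP[_ fin].
split.
  apply/(measurable_restrictT _ mO).
  by move: Lf => /andP[]; rewrite inE.
rewrite integral_mkcond; apply: le_lt_trans fin.
rewrite le_eqVlt; apply/orP; left; apply/eqP; apply: eq_integral => x _.
rewrite /= ger0_norm ?sqr_ge0// !patchE; case: ifP => //.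
by rewrite expr0n.
Qed.

Lemma L2_Omega_normE f : L2_Omega lambda Omega f ->
  L2_Omega_norm lambda Omega f = Num.sqrt (l2dot lambda Omega f f).
Proof.
move=> /L2_Omega_square_integrable sf; rewrite /L2_Omega_norm unlock.
rewrite poweR12_sqrt; last by apply: integral_ge0 => x _; exact: poweR_ge0.
rewrite (_ : (\int[lambda]_x _)%E = (l2dot lambda Omega f f)%:E)//.
rewrite -(l2dotE mO sf) [RHS]integral_mkcond; apply: eq_integral => x _.
rewrite /= powR_mulrn// real_normK ?num_real// !patchE.
by case: ifP => //; rewrite expr0n.
Qed.

Lemma neumann_rhs_linear f g : L2_Omega lambda Omega f ->
  continuous_functional_condition lambda K Omega g ->
  linear_on V (neumann_rhs lambda K Omega f g).
Proof.
move=> /L2_Omega_square_integrable sf [_ _ cG] a u v Vu Vv.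
have := sip_linear_r (l2dot_sip lambda mO) sf a (Vspace_sqr mO ndK Vu) (Vspace_sqr mO ndK Vv).
rewrite /neumann_rhs /l2dot => ->.
by rewrite (continuous_linear_on cG)//; ring.
Qed.

Lemma neumann_rhs_le f g v : L2_Omega lambda Omega f ->
  continuous_functional_condition lambda K Omega g -> V v ->
  `|neumann_rhs lambda K Omega f g v| <=
  (L2_Omega_norm lambda Omega f + Gamma_norm lambda K Omega g) * normV v.
Proof.
move=> Lf [_ _ cG] Vv; have sf := L2_Omega_square_integrable Lf.
have sv := Vspace_sqr mO ndK Vv.
rewrite mulrDl; apply: le_trans (ler_normD _ _) (lerD _ (operator_norm_le cG Vv)).
rewrite L2_Omega_normE// normVE//.
apply: le_trans (sip_norm_CauchySchwarz (l2dot_sip lambda mO) sf sv) _.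
rewrite ler_wpM2l ?sqrtr_ge0// ler_wsqrtr//.
rewrite (VdotE mO ndK Vv Vv) lerDl.
exact: (sip_ge0 (difference_sip lambda mO ndK measurableT)).
Qed.

Lemma Gamma_norm_ge0 g : continuous_functional_condition lambda K Omega g ->
  0 <= Gamma_norm lambda K Omega g.
Proof. by move=> [_ _]; exact: operator_norm_ge0. Qed.

(** The Poincare inequality controls the [L^2] part of the distance to [kerB];
the energy part is at most twice [Bform (v - w) (v - w)], which equals
[Bform v v] since [w] is a null vector of the form. *)
Lemma poincare_Vdot (C : R) :
  (forall v, V v -> (ereal_inf
     [set \int[lambda]_(x in Omega) ((v x - w x) ^+ 2)%:E | w in kerB lambda K Omega]
     <= (C * B v v)%:E)%E) ->
  forall v, V v -> forall e, 0 < e -> exists2 w, kerB lambda K Omega w &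
    dotV (v - w) (v - w) <= (C + 2) * B v v + e.
Proof.
move=> PC v Vv e e0.
have /ereal_inf_lt[_ [w [Vw Bw] <-] lt_w] :
    (ereal_inf [set \int[lambda]_(x in Omega) ((v x - w x) ^+ 2)%:E
     | w in kerB lambda K Omega] < (C * B v v + e)%:E)%E.
  by apply: le_lt_trans (PC v Vv) _; rewrite lte_fin ltrDl.
exists w => //; have Vvw := subspaceB subV Vv Vw.
move: lt_w; rewrite (l2dotE mO (Vspace_sqr mO ndK Vvw)) lte_fin => lt_w.
have sipB := Bform_sip lambda mO ndK.
have Bvw : B (v - w) (v - w) = B v v.
  rewrite -scaleN1r (sip_expand sipB)// (sipC sipB Vv Vw) (sip_null sipB Vw Vv Bw) Bw.
  by rewrite mul0r mulr0 mul0r !add0r.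
apply: le_trans (Vdot_le_Bform mO ndK Vvw) _; rewrite Bvw.
by rewrite [(C + 2) * _]mulrDl addrAC lerD2r ltW.
Qed.

Theorem neumann_problem : symmetric_kernel lambda K ->
  nonlocal_poincare lambda K Omega ->
  exists2 C : R, 0 < C &
    forall f g : T -> R,
      L2_Omega lambda Omega f ->
      continuous_functional_condition lambda K Omega g ->
      compatibility lambda K Omega f g ->
      [/\ exists u, weak_solution lambda K Omega f g u,
          forall u u', weak_solution lambda K Omega f g u ->
            (weak_solution lambda K Omega f g u' <->
             exists2 w, kerB lambda K Omega w &
               Veq lambda K Omega u' (u \+ w))
        & forall u, weak_solution lambda K Omega f g u ->
            exists p,
              [/\ is_kerB_projection lambda K Omega u p,
                  forall q, is_kerB_projection lambda K Omega u q ->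
                    Veq lambda K Omega q p
                & Vnorm lambda K Omega (u \- p) <=
                    C * (L2_Omega_norm lambda Omega f
                         + Gamma_norm lambda K Omega g)]].
Proof.
move=> symK [C C0 PC].
have sipB := Bform_sip lambda mO ndK.
have cV : fast_complete V dotV by exact: Vspace_fast_complete.
have BV v : V v -> B v v <= dotV v v by exact: Bform_le_Vdot.
have C2 : 0 < C + 2 by lra.
have coer := poincare_Vdot PC.
exists (C + 2); first exact: C2.
move=> f g Lf cg fg.
have linF := neumann_rhs_linear Lf cg.
have leF v (Vv : V v) := neumann_rhs_le Lf cg Vv.
set k := L2_Omega_norm _ _ _ + _ in leF *.
have k0 : 0 <= k.
  by rewrite addr_ge0 ?Gamma_norm_ge0// L2_Omega_normE// sqrtr_ge0.
split.
- have bF : bounded_functional V dotV (neumann_rhs lambda K Omega f g).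
    split=> //; exists (k ^+ 2) => v Vv.
    rewrite -[dotV v v]sqr_sqrtr ?(sip_ge0 sipV)// -normVE// -exprMn.
    rewrite -real_normK ?num_real// lerXn2r ?nnegrE ?leF//.
    by rewrite mulr_ge0// sqrtr_ge0.
  have [u Vu uE] := abstract_neumann_existence sipV sipB C2 cV BV coer bF fg.
  by exists u; split.
- move=> u u' [Vu uE]; split=> [[Vu' uE']|[w [Vw Bw] [Vk k_]]].
    have Vw := subspaceB subV Vu' Vu.
    exists (u' - u).
      split=> //; rewrite {1}(linear_onB (sip_linear sipB Vw))// uE// uE'//.
      exact: subrr.
    rewrite /Veq (_ : u' \- (u \+ (u' - u)) = 0); last first.
      by apply/funext => x; rewrite -[LHS]/(u' x - (u x + (u' x - u x))) -[RHS]/(0 : R); ring.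
    have V0 := subV.1; apply/(Vdot_eq0 mO ndK symK V0).
    by rewrite (linear_on0 subV (sip_linear sipV V0)).
  set k' := u' \- (u \+ w) in Vk k_.
  have u'E : u' = k' + (u + w).
    by apply/funext => x; rewrite -[RHS]/((u' x - (u x + w x)) + (u x + w x)); ring.
  have Vuw := subspaceD subV Vu Vw.
  have Bk : B k' k' = 0.
    apply/eqP; rewrite eq_le (sip_ge0 sipB Vk) andbT.
    have /(Vdot_eq0 mO ndK symK Vk) <- : kerV lambda K Omega k' by [].
    exact: BV.
  split=> [|v Vv]; rewrite u'E; first exact: (subspaceD subV Vk Vuw).
  have linB := sip_linear sipB Vv.
  rewrite (linear_onD linB Vk Vuw) (linear_onD linB Vu Vw) (uE v Vv).
  by rewrite (sip_null sipB Vk Vv Bk) (sip_null sipB Vw Vv Bw) add0r addr0.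
- move=> u [Vu uE].
  have [p Np pE] := null_space_projection sipV sipB cV BV Vu.
  have [Vp _] := Np; have Vup := subspaceB subV Vu Vp.
  exists p; split; first by split.
    move=> q [[Vq Bq] qE].
    have Vqp := subspaceB subV Vq Vp.
    apply/(Vdot_eq0 mO ndK symK Vqp).
    have Nqp : kerB lambda K Omega (q - p).
      exact: (subspaceB (sip_subspace (null_space_sip sipV sipB BV)) (conj Vq Bq) Np).
    have E : q - p = (u - p) - (u - q).
      by rewrite opprB [RHS]addrC addrA subrK.
    have Vuq := subspaceB subV Vu Vq.
    rewrite {1}E (linear_onB (sip_linear sipV Vqp) Vup Vuq).
    by rewrite (pE _ Nqp) (qE _ Nqp) subrr.
  rewrite normVE//.
  apply: (abstract_neumann_stability sipV sipB C2 coer k0 _ Vu uE Np pE).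
  by move=> v Vv; rewrite -normVE//; exact: leF.
Qed.

End neumann_data.

Theorem theorem6p2 (R : realType) (d : nat)
    (lambda : {measure set (borelRd R d) -> \bar R})
    (Omega : set 'rV[R]_d)
    (K : R.-sigmafker (borelRd R d) ~> (borelRd R d)) :
  open Omega -> Omega !=set0 -> (lambda Omega < +oo)%E ->
  nondegenerate_kernel K -> symmetric_kernel lambda K ->
  nonlocal_poincare lambda K Omega ->
  exists2 C : R, 0 < C &
    forall f g : 'rV[R]_d -> R,
      L2_Omega lambda Omega f ->
      continuous_functional_condition lambda K Omega g ->
      compatibility lambda K Omega f g ->
      [/\ exists u, weak_solution lambda K Omega f g u,
          forall u u', weak_solution lambda K Omega f g u ->
            (weak_solution lambda K Omega f g u' <->
             exists2 w, kerB lambda K Omega w &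
               Veq lambda K Omega u' (u \+ w))
        & forall u, weak_solution lambda K Omega f g u ->
            exists p,
              [/\ is_kerB_projection lambda K Omega u p,
                  forall q, is_kerB_projection lambda K Omega u q ->
                    Veq lambda K Omega q p
                & Vnorm lambda K Omega (u \- p) <=
                    C * (L2_Omega_norm lambda Omega f
                         + Gamma_norm lambda K Omega g)]].
Proof.
move=> oO _ _ ndK symK PK.
have mO : measurable (Omega : set (borelRd R d)) by exact: sub_gen_smallest.
exact: (neumann_problem mO ndK symK PK).
Qed.
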